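(* Let $F$ be a distribution on $\mathbb{R}$ with a density, and let $X, X_1, X_2,\ldots$ be i.i.d. with distribution $F$ and mean $\mu$. Suppose $\bar F(x)=1-F(x)=L(x)x^{-\alpha}$ for a slowly varying $L$ and $\alpha>2$, and $E|X|^{2+\delta}<\infty$ for some $\delta>0$. Let $\gamma=\gamma(n)=n\mu+\omega(\sqrt{n\log n})$ and let $u=u(n)=\omega\big((\gamma-n\mu)^\beta\big)$ for some $\beta>1$. Then, as $n\to\infty$, $$\tilde p(\tilde F_u)-\tilde p(F)=o(\tilde p(F)).$$
   Context: $S_n=X_1+\cdots+X_n$. For a distribution $G$, $\tilde p(G)=P_G(S_n\ge\gamma)$ is the probability that $S_n\ge\gamma$ when $X_1,\ldots,X_n$ are i.i.d. with law $G$. The truncated distribution $\tilde F_u$ is $\tilde F_u(x)=F(x)/F(u)$ for $x\le u$ and $1$ for $x>u$. $a_n=o(b_n)$: $a_n/b_n\to0$; $a_n=\omega(b_n)$: $a_n/b_n\to\infty$. *)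

(* Defs.v *)
From HB Require Import structures.
From mathcomp Require Import all_boot all_order all_algebra.
From mathcomp Require Import all_classical all_reals all_analysis.
Set Implicit Arguments. Unset Strict Implicit. Unset Printing Implicit Defensive.
Import Order.TTheory GRing.Theory Num.Theory.
Import numFieldNormedType.Exports.
Local Open Scope classical_set_scope.
Local Open Scope ring_scope.

(* Tail probabilities of the random walk S_k = X_1 + ... + X_k, where the X_i
   are i.i.d. with law G := P( . | D ), i.e. G(A) = P(A `&` D) / P(D).
   Recursion (independence + Fubini):
     P_G(S_0 >= t) = 1_{0 >= t},
     P_G(S_{k+1} >= t) = \int P_G(S_k >= t - x) G(dx)
                       = P(D)^-1 * \int_(x in D) P_G(S_k >= t - x) P(dx). *)
Fixpoint cond_walk_tail (R : realType) (P : probability R R) (D : set R)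
    (k : nat) (t : R) : \bar R :=
  match k with
  | 0%N => if (t <= 0)%R then 1%E else 0%E
  | k.+1 => ((fine (P D))^-1)%:E *
            \int[P]_(x in D) cond_walk_tail P D k (t - x)
  end.

Definition ptilde (R : realType) (P : probability R R) (n : nat) (g : R) : R :=
  fine (cond_walk_tail P setT n g).

(* p~(F~_u) = P_{F~_u}(S_n >= gamma), where F~_u is F conditioned on (-oo, u],
   i.e. F~_u(x) = F(x)/F(u) for x <= u and 1 for x > u. *)
Definition ptilde_trunc (R : realType) (P : probability R R) (u : R) (n : nat)
    (g : R) : R :=
  fine (cond_walk_tail P `]-oo, u]%classic n g).

Definition survival (R : realType) (P : probability R R) (x : R) : R :=
  fine (P `]x, +oo[%classic).

Definition slowly_varying (R : realType) (L : R -> R) : Prop :=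
  (\forall x \near +oo, 0 < L x) /\
  forall c : R, 0 < c -> L (c * x) / L x @[x --> +oo] --> (1 : R).

(* Main.v *)
(** By the principle of one big jump the sum reaches gamma = n mu + y when some
    single X_i exceeds v := mu + 2 y while, the others being at most v, their sum
    stays above (n - 1) mu - y. These events are disjoint, and Chebyshev's
    inequality with n = o(y^2) makes the second requirement cost a factor close
    to 1, so p~(F) >= n F-bar(v) / 2 eventually. Truncating at u changes the
    probability by at most n F-bar(u) / (1 - n F-bar(u)). Since u/v tends to
    infinity, F-bar(u) <= F-bar(c v) ~ c^-alpha F-bar(v) for every c, whence
    F-bar(u) = o(F-bar(v)); monotonicity replaces Potter bounds. *)

Require Import Defs.
From HB Require Import structures.
From mathcomp Require Import all_boot all_order all_algebra.
From mathcomp Require Import all_classical all_reals all_analysis.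
From mathcomp Require Import measurable_realfun.
From mathcomp Require Import ring lra.
Set Implicit Arguments.
Unset Strict Implicit.
Unset Printing Implicit Defensive.
Import Order.TTheory GRing.Theory Num.Theory.
Import numFieldNormedType.Exports.
Local Open Scope classical_set_scope.
Local Open Scope ring_scope.

(* P(S_k >= t, X_1 \in D, ..., X_k \in D), the unnormalized [cond_walk_tail]. *)
Fixpoint walk_mass (R : realType) (P : probability R R) (D : set R)
    (k : nat) (t : R) : R :=
  match k with
  | 0%N => if t <= 0 then 1 else 0
  | k.+1 => \int[P]_(x in D) walk_mass P D k (t - x)
  end.

(** * Integrals of real functions against a probability *)

Section RealIntegral.
Context {R : realType} (P : probability R R).
Implicit Types (D : set R) (f : R -> R).

Lemma integrable_bounded D f (M : R) : measurable D -> measurable_fun D f ->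
  (forall x, `|f x| <= M) -> P.-integrable D (EFin \o f).
Proof.
move=> mD mf fM; apply: measurable_bounded_integrable => //.
  by rewrite (le_lt_trans (probability_le1 P mD))// ltry.
exists M; split; first exact: num_real.
by move=> N MN x _; exact: le_trans (fM x) (ltW MN).
Qed.

Lemma RintegralC D f : measurable D -> P.-integrable setT (EFin \o f) ->
  \int[P]_x f x = \int[P]_(x in D) f x + \int[P]_(x in ~` D) f x.
Proof.
move=> mD fi; rewrite -Rintegral_setU ?setUv//; first exact: measurableC.
by apply/disj_setPS => x [].
Qed.

Lemma fine_probability_bounds D : measurable D -> 0 <= fine (P D) <= 1.
Proof.
move=> mD; rewrite fine_ge0//= -lee_fin fineK ?probability_le1//.
exact: fin_num_measure.
Qed.

End RealIntegral.

(** * Survival function and distribution function *)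

Section Survival.
Context {R : realType} (P : probability R R).

Lemma survival_ge0 (x : R) : 0 <= survival P x.
Proof. by rewrite fine_ge0. Qed.

Lemma survival_le (x y : R) : x <= y -> survival P y <= survival P x.
Proof.
move=> xy; apply: fine_le; [exact: fin_num_measure..|].
apply: le_measure; rewrite ?inE//; apply: subset_itvr; by rewrite bnd_simp.
Qed.

Lemma fine_probability_itvNyc (x : R) : fine (P `]-oo, x]%classic) = 1 - survival P x.
Proof.
by rewrite -setCitvr probability_setC// fineB// fin_num_measure.
Qed.

End Survival.

(** * Comparison of constrained and free walks *)

Section WalkMass.
Context {R : realType} (P : probability R R).

(** Both claims share one induction: monotonicity in [t] gives the measurability, and the bounds the
    integrability, that the next integral needs. *)
Lemma walk_mass_bounds_homo D k : measurable D ->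
  (forall t, 0 <= walk_mass P D k t <= 1) /\
  {homo walk_mass P D k : s t /~ s <= t}.
Proof.
move=> mD; elim: k => [|k [b h]] /=.
  split => [t|s t st]; first by case: ifP; rewrite ?lexx ?ler01.
  case: (leP s 0) => s0; last by case: ifP.
  by rewrite (le_trans st s0).
have I t : P.-integrable D (EFin \o (fun x => walk_mass P D k (t - x))).
  apply: (@integrable_bounded _ _ _ _ 1) => // [|x].
    by apply: nondecreasing_measurable => // x y xy; apply: h; rewrite lerB.
  by have /andP[b0 b1] := b (t - x); rewrite ger0_norm.
have I1 : P.-integrable D (EFin \o (fun=> 1 : R)).
  exact: finite_measure_integrable_cst.
split => [t|s t st].
  rewrite Rintegral_ge0/= => [|x _]; last by case/andP: (b (t - x)).
  have /andP[_ D1] := fine_probability_bounds P mD.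
  rewrite (le_trans _ D1)// -[leRHS]mul1r -(Rintegral_cst P mD 1).
  by apply: le_Rintegral => // x _; case/andP: (b (t - x)).
by apply: le_Rintegral => // x _; apply: h; rewrite lerB.
Qed.

Lemma walk_mass_ge0 D k t : measurable D -> 0 <= walk_mass P D k t.
Proof. by move=> mD; have [b _] := walk_mass_bounds_homo k mD; case/andP: (b t). Qed.

Lemma walk_mass_le1 D k t : measurable D -> walk_mass P D k t <= 1.
Proof. by move=> mD; have [b _] := walk_mass_bounds_homo k mD; case/andP: (b t). Qed.

Lemma walk_mass_homo D k : measurable D ->
  {homo walk_mass P D k : s t /~ s <= t}.
Proof. by move=> mD; have [] := walk_mass_bounds_homo k mD. Qed.

Lemma integrable_walk_mass D E k t : measurable D -> measurable E ->
  P.-integrable E (EFin \o (fun x => walk_mass P D k (t - x))).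
Proof.
move=> mD mE; apply: (@integrable_bounded _ _ _ _ 1) => // [|x].
  apply: nondecreasing_measurable => // x y xy.
  by apply: walk_mass_homo => //; rewrite lerB.
by rewrite ger0_norm ?walk_mass_ge0 ?walk_mass_le1.
Qed.

(** The normalization leaves the integral once per increment; from here on only real-valued masses
    are handled. *)
Lemma cond_walk_tailE D k t : measurable D ->
  cond_walk_tail P D k t = (walk_mass P D k t / fine (P D) ^+ k)%:E.
Proof.
move=> mD; elim: k t => [|k IHk] t /=.
  by rewrite expr0 divr1; case: ifP.
under eq_integral do rewrite IHk mulrC.
under eq_integral do rewrite EFinM.
rewrite integralZl//; last exact: integrable_walk_mass.
rewrite -[X in (_ * (_ * X))%E]fineK; last first.
  by apply: integrable_fin_num => //; exact: integrable_walk_mass.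
rewrite -!EFinM exprS invfM; congr EFin.
by rewrite mulrA mulrC.
Qed.

Lemma walk_mass_le_setT D k t : measurable D ->
  walk_mass P D k t <= walk_mass P setT k t.
Proof.
move=> mD; elim: k t => [//|k IHk] t /=.
rewrite (@RintegralC _ _ D)//; last exact: integrable_walk_mass.
rewrite -[leLHS]addr0 lerD//.
  by apply: le_Rintegral => // *; exact: integrable_walk_mass.
by apply: Rintegral_ge0 => x _; exact: walk_mass_ge0.
Qed.

(** Union bound: the free walk gains only paths with some increment outside [D], at a cost of at
    most one P(outside [D]) per increment. *)
Lemma walk_mass_setT_le D k t : measurable D ->
  walk_mass P setT k t <= walk_mass P D k t + k%:R * fine (P (~` D)).
Proof.
move=> mD; have mC := measurableC mD.
have /andP[p0 p1] := fine_probability_bounds P mC.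
have c E (r : R) : measurable E -> P.-integrable E (EFin \o (fun=> r)).
  by move=> mE; exact: (@integrable_bounded _ _ _ _ `|r|).
elim: k t => [|k IHk] t /=; first by rewrite mul0r addr0.
rewrite (@RintegralC _ _ D)//; last exact: integrable_walk_mass.
rewrite -natr1 mulrDl mul1r addrA lerD//.
  apply: (@le_trans _ _ (\int[P]_(x in D) (walk_mass P D k (t - x) +
      k%:R * fine (P (~` D))))).
    apply: le_Rintegral => //; first exact: integrable_walk_mass.
    under [X in integrable _ _ X]eq_fun do rewrite /= EFinD.
    by apply: integrableD => //; [exact: integrable_walk_mass|exact: c].
  rewrite RintegralD//; [|exact: integrable_walk_mass|exact: c].
  rewrite lerD2l Rintegral_cst// ler_piMr ?mulr_ge0//.
  by case/andP: (fine_probability_bounds P mD).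
apply: (@le_trans _ _ (\int[P]_(x in ~` D) 1)).
  apply: le_Rintegral => //; [exact: integrable_walk_mass|exact: c|].
  by move=> x _; exact: walk_mass_le1.
by rewrite Rintegral_cst// mul1r.
Qed.

(* The events "X_i > v and X_j <= v for all j <> i" are disjoint, and on each of
   them S_k >= t as soon as the other increments sum up to t - v. *)
Lemma walk_mass_one_big_jump v k t :
  k.+1%:R * survival P v * walk_mass P `]-oo, v]%classic k (t - v) <=
  walk_mass P setT k.+1 t.
Proof.
set D := `]-oo, v]%classic.
have mD : measurable D by exact: measurable_itv.
have mC : measurable (~` D) by exact: measurableC.
have SE : survival P v = fine (P (~` D)) by rewrite setCitvl.
have c E (r : R) : measurable E -> P.-integrable E (EFin \o (fun=> r)).
  by move=> mE; exact: finite_measure_integrable_cst.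
have iW E j s : measurable E ->
    P.-integrable E (EFin \o (fun x => walk_mass P setT j (s - x))).
  by move=> mE; exact: integrable_walk_mass.
have jump j s : survival P v * walk_mass P D j (s - v) <=
    \int[P]_(x in ~` D) walk_mass P setT j (s - x).
  rewrite SE mulrC -Rintegral_cst//; apply: le_Rintegral => //.
  - exact: c.
  - exact: iW.
  move=> x; rewrite /D setCitvl/= in_itv/= andbT => vx.
  apply: le_trans (walk_mass_le_setT _ _ mD) _.
  by apply: walk_mass_homo => //; rewrite lerB// ltW.
elim: k t => [|k IHk] t.
  rewrite [leRHS]/= (RintegralC mD (iW setT 0%N t measurableT)) mul1r.
  rewrite -[leLHS]add0r lerD ?(jump 0%N)//.
  by apply: Rintegral_ge0 => x _; exact: walk_mass_ge0.
(* Split on the first increment: beyond [v] it is itself the jump and [jump] supplies one term;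
   otherwise the induction hypothesis supplies the other [k.+1]. *)
rewrite [leRHS](RintegralC mD (iW setT k.+1 t measurableT)).
rewrite -natr1 2!mulrDl mul1r lerD ?jump//.
have ic : P.-integrable D (EFin \o (fun x => walk_mass P D k (t - v - x))).
  exact: integrable_walk_mass.
rewrite [walk_mass P D k.+1 _]/= -RintegralZl//.
apply: le_Rintegral => //; first last.
- by move=> x _; rewrite [t - v - x]addrAC; exact: IHk.
- exact: iW.
under [X in integrable _ _ X]eq_fun do rewrite /= EFinM.
exact: integrableZl.
Qed.

(** * Chebyshev's inequality for one increment and for the walk *)

Section Chebyshev.
Context (mu : R) (Hint : P.-integrable setT (fun x => x%:E))
  (Hvar : P.-integrable setT (EFin \o (fun x => (x - mu) ^+ 2)))
  (Hmean : (\int[P]_x x%:E = mu%:E)%E).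
Let V := \int[P]_x (x - mu) ^+ 2.

Lemma survival_chebyshev y : 0 < y -> survival P (mu + y) <= V / y ^+ 2.
Proof.
move=> y0; rewrite ler_pdivlMr ?exprn_gt0// mulrC.
set A := `]mu + y, +oo[%classic; have mA : measurable A by exact: measurable_itv.
have iA := integrableS measurableT mA (@subsetT _ A) Hvar.
have ic : P.-integrable A (EFin \o (fun=> y ^+ 2)).
  exact: finite_measure_integrable_cst.
rewrite -(Rintegral_cst P mA) /V (RintegralC mA Hvar).
rewrite -[leLHS]addr0 lerD//; last first.
  by apply: Rintegral_ge0 => x _; exact: sqr_ge0.
apply: le_Rintegral => // x; rewrite /A/= in_itv/= andbT => yx.
by rewrite lerXn2r ?nnegrE; lra.
Qed.

(** Markov's inequality for (r + S_k - k mu)^2, whose mean is [k%:R * V + r ^+ 2]. The shift [r]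
    carries the deviation of the increments already integrated out, which makes the induction on [k]
    close. *)
Lemma walk_mass_chebyshev Y k r : 0 < Y ->
  1 - walk_mass P setT k (k%:R * mu - Y - r) <= (k%:R * V + r ^+ 2) / Y ^+ 2.
Proof.
move=> Y0; rewrite ler_pdivlMr ?exprn_gt0//.
have c (s : R) : P.-integrable setT (EFin \o (fun=> s)).
  exact: finite_measure_integrable_cst.
have P1 (s : R) : \int[P]_x s = s.
  rewrite Rintegral_cst// -[RHS]mulr1; congr *%R.
  exact: (congr1 fine (probability_setT P)).
elim: k r => [|k IHk] r.
  rewrite !mul0r !add0r/=; case: ifPn => [_|].
    by rewrite subrr mul0r sqr_ge0.
  by rewrite -ltNge => h; rewrite subr0 mul1r -(sqrrN r) lerXn2r ?nnegrE; lra.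
pose t := k.+1%:R * mu - Y - r.
have iW : P.-integrable setT (EFin \o (fun x => walk_mass P setT k (t - x))).
  exact: integrable_walk_mass.
have iX : P.-integrable setT (EFin \o (fun x => x - mu)).
  by apply: (@integrableB _ _ _ P setT measurableT EFin (fun=> mu%:E)) => //; exact: c.
have i1 : P.-integrable setT (EFin \o (fun x => 1 - walk_mass P setT k (t - x))).
  by apply: (@integrableB _ _ _ P setT measurableT (fun=> 1%:E)
    (EFin \o (fun x => walk_mass P setT k (t - x)))) => //; exact: c.
have iZ : P.-integrable setT (EFin \o (fun x => 2 * r * (x - mu))).
  by under [X in integrable _ _ X]eq_fun do rewrite /= EFinM; exact: integrableZl.
have iD : P.-integrable setT
    (EFin \o (fun x => (x - mu) ^+ 2 + 2 * r * (x - mu))).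
  by apply: (@integrableD _ _ _ P setT measurableT
    (EFin \o (fun x => (x - mu) ^+ 2))
    (EFin \o (fun x => 2 * r * (x - mu)))).
have iS : P.-integrable setT (EFin \o (fun x =>
    (x - mu) ^+ 2 + 2 * r * (x - mu) + (k%:R * V + r ^+ 2))).
  by apply: (@integrableD _ _ _ P setT measurableT
    (EFin \o (fun x => (x - mu) ^+ 2 + 2 * r * (x - mu)))
    (EFin \o (fun=> k%:R * V + r ^+ 2))) => //; exact: c.
(* The cross term [2 * r * (x - mu)] integrates to 0, so the second moments add up. *)
have mean0 : \int[P]_x (x - mu) = 0.
  rewrite (RintegralB (f1 := id) measurableT Hint (c mu)) P1.
  by rewrite /Rintegral Hmean/= subrr.
have -> : 1 - walk_mass P setT k.+1 t =
    \int[P]_x (1 - walk_mass P setT k (t - x)).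
  by rewrite RintegralB// P1.
rewrite -RintegralZr//.
have -> : k.+1%:R * V + r ^+ 2 = \int[P]_x
    ((x - mu) ^+ 2 + 2 * r * (x - mu) + (k%:R * V + r ^+ 2)).
  by rewrite RintegralD// P1 RintegralD// RintegralZl// mean0 -natr1 -/V; ring.
apply: le_Rintegral => //.
  by under [X in integrable _ _ X]eq_fun do rewrite /= EFinM; exact: integrableZr.
(* Once the first increment equals [x], the accumulated deviation is [r + (x - mu)]. *)
move=> x _; have := IHk (r + (x - mu)).
have -> : k%:R * mu - Y - (r + (x - mu)) = t - x by rewrite /t -natr1; ring.
by move=> /le_trans; apply; rewrite le_eqVlt; apply/orP; left; apply/eqP; ring.
Qed.

End Chebyshev.
End WalkMass.

(** * Tail ratio, and bounds for the free and truncated probabilities *)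

Section Asymptotics.
Context {R : realType} (P : probability R R).

Lemma survival_ratio_small (alpha e : R) : 1 <= alpha ->
  (exists L : R -> R, slowly_varying L /\
     forall x, 0 < x -> survival P x = L x * x `^ (- alpha)) ->
  0 < e -> exists c, \forall v \near +oo,
    0 < survival P v /\ forall u, c * v <= u -> survival P u <= e * survival P v.
Proof.
move=> alpha1 [L [[Lpos Lsv] SL]] e0.
(* Since L(c v) / L(v) <= 2 eventually and c^-alpha <= 1/c, the ratio of survivals is at most 2/c,
   which this [c] brings below [e]. *)
pose c := 1 + 2 / e.
have c1 : 1 <= c by rewrite lerDl divr_ge0// ltW.
have c0 : 0 < c by rewrite (lt_le_trans _ c1).
exists c.
have L2 : \forall v \near +oo, L (c * v) / L v <= 2.
  by apply: cvgr_le (Lsv c c0) _ _; rewrite ltr1n.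
near=> v.
have v0 : 0 < v by near: v; exact: nbhs_pinfty_gt.
have Lv : 0 < L v by near: v.
have Sv : 0 < survival P v by rewrite SL// mulr_gt0// powR_gt0.
split => // u cvu.
apply: le_trans (survival_le P cvu) _.
rewrite SL ?mulr_gt0// powRM ?(ltW c0) ?(ltW v0)// SL// !mulrA ler_wpM2r ?powR_ge0//.
have Lcv : L (c * v) <= 2 * L v by rewrite -ler_pdivrMr//; near: v.
have ca : c `^ (- alpha) <= c^-1.
  by rewrite -powR_inv1 ?(ltW c0)// ler_powR// lerN2.
apply: (@le_trans _ _ (2 * L v * c^-1)).
  apply: (@le_trans _ _ (2 * L v * c `^ (- alpha))).
    by rewrite ler_wpM2r ?powR_ge0.
  by rewrite ler_wpM2l// mulr_ge0// (ltW Lv).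
rewrite mulrAC ler_wpM2r ?(ltW Lv)// ler_pdivrMr// /c mulrDr mulr1.
rewrite (mulrC e) divfK ?gt_eqF//; lra.
Unshelve. all: by end_near. Qed.

Lemma ptildeE n g : ptilde P n g = walk_mass P setT n g.
Proof.
rewrite /ptilde cond_walk_tailE//=.
by rewrite (congr1 fine (probability_setT P)) expr1n divr1.
Qed.

(** The last factor bounds from below the chance that the [n] other increments sum to at least n mu
    - y while none exceeds v: Chebyshev costs the first subtracted term, the cap at v the second. *)
Lemma ptilde_ge_one_big_jump mu V n y : 0 < y ->
  1 - walk_mass P setT n (n%:R * mu - y) <= n%:R * V / y ^+ 2 ->
  0 <= V ->
  n.+1%:R * survival P (mu + 2 * y) *
    (1 - n.+1%:R * V / y ^+ 2 - n.+1%:R * survival P (mu + 2 * y)) <=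
  ptilde P n.+1 (n.+1%:R * mu + y).
Proof.
move=> y0 cheb V0; set v := mu + 2 * y.
have mD : measurable (`]-oo, v]%classic : set R) by exact: measurable_itv.
have S0 : 0 <= survival P v by exact: survival_ge0.
rewrite ptildeE; apply: le_trans (walk_mass_one_big_jump P v n _).
rewrite ler_wpM2l ?mulr_ge0//.
have -> : n.+1%:R * mu + y - v = n%:R * mu - y by rewrite /v -natr1; ring.
have := walk_mass_setT_le P n (n%:R * mu - y) mD.
rewrite setCitvl -/(survival P v).
have : n%:R * V / y ^+ 2 <= n.+1%:R * V / y ^+ 2.
  by rewrite ler_pM2r ?invr_gt0 ?exprn_gt0// ler_wpM2r// ler_nat.
have : n%:R * survival P v <= n.+1%:R * survival P v.
  by rewrite ler_wpM2r// ler_nat.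
lra.
Qed.

(** Before normalization, truncation removes at most [s] from [p]; the normalizer [q] = F(u)^n lies
    between [1 - s] and 1. Hence [A - p * q] lies between [- s] and [s], and dividing by [q] gives
    the bound. *)
Lemma ptilde_trunc_error u n g : n%:R * survival P u < 1 ->
  `|ptilde_trunc P u n g - ptilde P n g| <=
  n%:R * survival P u / (1 - n%:R * survival P u).
Proof.
set s := n%:R * survival P u => s1.
have mD : measurable (`]-oo, u]%classic : set R) by exact: measurable_itv.
rewrite ptildeE /ptilde_trunc cond_walk_tailE//= fine_probability_itvNyc.
have S0 : 0 <= survival P u by exact: survival_ge0.
have S1 : survival P u <= 1.
  by case/andP: (@fine_probability_bounds _ P `]u, +oo[%classic (measurable_itv _)).
set q := _ ^+ n.
have q1 : q <= 1 by rewrite exprn_ile1//; lra.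
(* Bernoulli's inequality. *)
have qs : 1 - s <= q.
  rewrite /q /s; elim: n {s s1 q q1} => [|n IHn]; first by rewrite mul0r subr0.
  rewrite exprS; apply: (@le_trans _ _ ((1 - survival P u) * (1 - n%:R * survival P u))).
    have : 0 <= n%:R * survival P u * survival P u by rewrite !mulr_ge0.
    by rewrite -natr1; lra.
  by rewrite ler_wpM2l//; lra.
have q0 : 0 < q by lra.
have := walk_mass_le_setT P n g mD.
have := walk_mass_setT_le P n g mD.
rewrite setCitvl -/(survival P u) -/s.
have := @walk_mass_ge0 _ P setT n g measurableT.
have := @walk_mass_le1 _ P setT n g measurableT.
set A := walk_mass P `]-oo, u]%classic n g; set p := walk_mass P setT n g => p1 p0 pA Ap.
have -> : A / q - p = (A - p * q) / q by rewrite mulrBl mulfK ?gt_eqF.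
rewrite normrM normfV (gtr0_norm q0).
apply: ler_pM; rewrite ?invr_ge0 ?(ltW q0)//.
  by rewrite ler_norml; apply/andP; split; nra.
by rewrite lef_pV2 ?posrE//; lra.
Qed.

End Asymptotics.

(** * Choice of thresholds and passage to the limit *)

Unset Implicit Arguments.

Theorem theorem5 (R : realType) (P : probability R R)
  (mu alpha delta beta : R) (gamma u : nat -> R)
  (* F has a density w.r.t. Lebesgue measure *)
  (Hdens : exists f : R -> R, measurable_fun setT f /\ (forall x, 0 <= f x) /\
     forall A, measurable A ->
       (P A = \int[lebesgue_measure]_(x in A) (f x)%:E)%E)
  (* regularly varying tail F-bar(x) = L(x) x^-alpha with alpha > 2 *)
  (Halpha : 2 < alpha)
  (Htail : exists L : R -> R, slowly_varying L /\
     forall x, 0 < x -> survival P x = L x * x `^ (- alpha))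
  (* E|X|^(2+delta) < oo for some delta > 0 *)
  (Hdelta : 0 < delta)
  (Hmom : (\int[P]_x (`|x| `^ (2 + delta))%:E < +oo)%E)
  (* mu is the mean of X *)
  (Hint : P.-integrable setT (fun x => x%:E))
  (Hmean : (\int[P]_x x%:E = mu%:E)%E)
  (* gamma = n mu + omega(sqrt(n log n)) *)
  (Hgamma : (gamma n - n%:R * mu) / Num.sqrt (n%:R * ln n%:R) @[n --> \oo]
              --> +oo)
  (* u = omega((gamma - n mu)^beta), beta > 1 *)
  (Hbeta : 1 < beta)
  (Hu : u n / (gamma n - n%:R * mu) `^ beta @[n --> \oo] --> +oo) :
  (ptilde_trunc P (u n) n (gamma n) - ptilde P n (gamma n)) / ptilde P n (gamma n)
    @[n --> \oo] --> 0.
Proof.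
set y := fun n => gamma n - n%:R * mu.
(* Domination: (x - mu)^2 <= 2 x^2 + 2 mu^2, and x^2 <= 1 + |x|^(2 + delta) by splitting at |x| =
   1. *)
have Hvar : P.-integrable setT (EFin \o (fun x => (x - mu) ^+ 2)).
  have c (s : R) : P.-integrable setT (EFin \o (fun=> s)).
    exact: finite_measure_integrable_cst.
  have mp : measurable_fun setT (fun x : R => `|x| `^ (2 + delta)).
    exact: measurableT_comp (@measurable_powR R _) (@normr_measurable R setT).
  have ip : P.-integrable setT (EFin \o (fun x => `|x| `^ (2 + delta))).
    apply/integrableP; split; first exact/measurable_EFinP.
    under eq_integral do rewrite /= ger0_norm ?powR_ge0//.
    exact: Hmom.
  have ib : P.-integrable setT
      (EFin \o (fun x => 2 * (1 + mu ^+ 2) + 2 * `|x| `^ (2 + delta))).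
    apply: (@integrableD _ _ _ P setT measurableT
      (EFin \o (fun=> 2 * (1 + mu ^+ 2)))
      (EFin \o (fun x => 2 * `|x| `^ (2 + delta)))) => //.
    by under [X in integrable _ _ X]eq_fun do rewrite /= EFinM; exact: integrableZl.
  apply: le_integrable ib => //.
    by apply/measurable_EFinP; apply: measurable_funX; apply: measurable_funB.
  move=> x _; rewrite /= lee_fin ger0_norm ?sqr_ge0// ger0_norm; last first.
    by rewrite addr_ge0// mulr_ge0 ?powR_ge0// addr_ge0 ?sqr_ge0.
  have : x ^+ 2 <= 1 + `|x| `^ (2 + delta).
    have [x1|x1] := leP `|x| 1.
      have : x ^+ 2 <= 1 by rewrite -real_normK ?num_real// exprn_ile1.
      by have := powR_ge0 `|x| (2 + delta); lra.
    have : x ^+ 2 <= `|x| `^ (2 + delta).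
      rewrite -real_normK ?num_real// -powR_mulrn// ler_powR ?(ltW x1)//.
      by rewrite lerDl ltW.
    lra.
  have := sqr_ge0 (x + mu); lra.
pose V := \int[P]_x (x - mu) ^+ 2.
have V0 : 0 <= V by apply: Rintegral_ge0 => x _; exact: sqr_ge0.
(* For n >= e the logarithm is at least 1, so y eventually exceeds any multiple of sqrt n. *)
have y_sqrt M : 0 <= M -> \forall n \near \oo, M * Num.sqrt n%:R <= y n.
  move=> M0; near=> n.
  have ne : expR 1 <= n%:R :> R by near: n; exact: nbhs_infty_ger.
  have n0 : 0 < n%:R :> R by rewrite (lt_le_trans _ ne)// expR_gt0.
  have ln1 : 1 <= ln (n%:R : R) by rewrite -ler_expR lnK.
  have : M <= y n / Num.sqrt (n%:R * ln n%:R).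
    by near: n; move/cvgryPge : Hgamma; apply.
  rewrite ler_pdivlMr ?sqrtr_gt0 ?mulr_gt0 ?(lt_le_trans _ ln1)//.
  apply: le_trans; rewrite ler_wpM2l// ler_sqrt ?mulr_ge0 ?(ltW n0)//; last lra.
  by rewrite ler_peMr ?(ltW n0).
have y_large M : 0 <= M -> \forall n \near \oo, M <= y n.
  move=> M0; near=> n.
  have : M * Num.sqrt n%:R <= y n by near: n; exact: y_sqrt.
  apply: le_trans; rewrite ler_peMr//.
  rewrite -{1}sqrtr1 ler_sqrt ?ler0n// ler1n.
  by near: n; exact: nbhs_infty_gt.
apply/cvgrPdist_le => e e0; rewrite /=.
(* The 4 pays for the factors 1/2 in [ptilde P n (gamma n)] >= T / 2 and in 1 - s >= 1/2; the cap 1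
   keeps [s] itself small. *)
pose e' := Num.min e 1 / 4.
have e'0 : 0 < e' by rewrite divr_gt0// lt_min e0 ltr01.
have e'e : 4 * e' <= e by rewrite /e' mulrC divfK// ge_min lexx.
have e'1 : 4 * e' <= 1 by rewrite /e' mulrC divfK// ge_min lexx orbT.
have alpha1 : 1 <= alpha by lra.
have [c Hc] := survival_ratio_small alpha1 Htail e'0.
(* An explicit threshold lets the estimate be used at the point mu + 2 y, which varies with n. *)
have [B HB] : exists B, forall v, B < v -> 0 < survival P v /\
    forall u, c * v <= u -> survival P u <= e' * survival P v.
  by case: Hc => B [_ HB]; exists B.
near=> n.
have n1 : (0 < n)%N by near: n; exact: nbhs_infty_gt.
(* As (4 V + 1)^2 >= 4 V, this yields n V / y^2 <= 1/4. *)
have yV : (4 * V + 1) * Num.sqrt n%:R <= y n by near: n; apply: y_sqrt; lra.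
have y1 : 1 <= y n by near: n; exact: y_large.
have y0 : 0 < y n by lra.
have ymu : `|mu| <= y n by near: n; exact: y_large.
have yB : `|B| + 1 <= y n by near: n; apply: y_large; rewrite addr_ge0.
(* This threshold gives 3 |c| <= y^(beta - 1), where beta > 1 enters; with v <= 3 y it follows that
   c v <= y^beta <= u. *)
have yc : (3 * `|c|) `^ (beta - 1)^-1 <= y n.
  by near: n; apply: y_large; exact: powR_ge0.
have uy : y n `^ beta <= u n.
  have : 1 <= u n / y n `^ beta by near: n; move/cvgryPge : Hu; apply.
  by rewrite ler_pdivlMr ?powR_gt0// mul1r.
set v := mu + 2 * y n.
have mule : - y n <= mu <= y n by rewrite -ler_norml.
have Bv : B < v by have := ler_norm B; rewrite /v; lra.
have [Sv Su] := HB v Bv.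
have {Su} Su : survival P (u n) <= e' * survival P v.
  apply: Su; apply: le_trans uy.
  have b1 : beta - 1 != 0 by rewrite subr_eq0 gt_eqF.
  have yb : 3 * `|c| <= y n `^ (beta - 1).
    rewrite -[leLHS]powRr1 ?mulr_ge0// -[X in _ `^ X <= _](mulVf b1) powRrM.
    by rewrite ge0_ler_powR ?nnegrE ?powR_ge0 ?(ltW y0)// subr_ge0 ltW.
  have -> : beta = 1 + (beta - 1) by ring.
  rewrite powRD ?powRr1 ?(ltW y0)//; last by rewrite (gt_eqF y0) implybT.
  apply: (@le_trans _ _ (`|c| * (3 * y n))).
    apply: (@le_trans _ _ (`|c| * v)).
      by rewrite ler_wpM2r ?ler_norm// /v; lra.
    by rewrite ler_wpM2l// /v; lra.
  by rewrite mulrCA mulrA mulrC ler_wpM2l// (ltW y0).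
set s := n%:R * survival P (u n).
set T := n%:R * survival P v.
have T0 : 0 < T by rewrite mulr_gt0// ltr0n.
have sT : s <= e' * T by rewrite /s /T mulrCA ler_wpM2l.
have nV : n%:R * V / y n ^+ 2 <= 4^-1.
  rewrite ler_pdivrMr ?exprn_gt0//.
  have : ((4 * V + 1) * Num.sqrt n%:R) ^+ 2 <= y n ^+ 2.
    rewrite lerXn2r ?nnegrE ?(ltW y0)// mulr_ge0 ?sqrtr_ge0//; lra.
  rewrite exprMn sqr_sqrtr ?ler0n// => h.
  have nn : 0 <= n%:R :> R by rewrite ler0n.
  have : 0 <= n%:R * V ^+ 2 by rewrite mulr_ge0 ?sqr_ge0.
  have : 0 <= n%:R * V by rewrite mulr_ge0.
  lra.
(* Chebyshev for a single increment at deviation 2 y, taken n times. *)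
have T4 : T <= 4^-1.
  apply: le_trans nV; rewrite -mulrA ler_wpM2l ?ler0n//.
  have y20 : 0 < 2 * y n by lra.
  apply: le_trans (survival_chebyshev Hvar y20) _.
  rewrite ler_wpM2l// lef_pV2 ?posrE ?exprn_gt0//.
  by rewrite lerXn2r ?nnegrE; lra.
(* One increment is the jump, leaving [n.-1] others; two losses of at most 1/4 each leave the factor
   1/2. *)
have pT : T / 2 <= ptilde P n (gamma n).
  have cheb : 1 - walk_mass P setT n.-1 (n.-1%:R * mu - y n) <=
      n.-1%:R * V / y n ^+ 2.
    have := @walk_mass_chebyshev _ P mu Hint Hvar Hmean (y n) n.-1 0 y0.
    by rewrite subr0 expr0n/= addr0.
  have := ptilde_ge_one_big_jump y0 cheb V0; rewrite prednK// subrKC -/v -/T.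
  by apply: le_trans; rewrite ler_pM2l//; lra.
have p0 : 0 < ptilde P n (gamma n) by lra.
have s4 : s <= 4^-1 by nra.
rewrite sub0r normrN normrM normfV (gtr0_norm p0) ler_pdivrMr//.
apply: le_trans (ptilde_trunc_error _ _) _; rewrite -/s; first lra.
rewrite ler_pdivrMr; last lra.
apply: (@le_trans _ _ (e' * T)) => //.
have ep : 4 * e' * (T / 2) <= e * ptilde P n (gamma n).
  by apply: ler_pM => //; lra.
apply: (@le_trans _ _ (e * ptilde P n (gamma n) * (1 / 2))); last first.
  by rewrite ler_pM2l ?mulr_gt0//; lra.
lra.
Unshelve. all: by end_near. Qed.
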